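(* Let $P=T_1\times\cdots\times T_n$ be a finite product of trees (each factor equipped with its path metric) and let $G$ be a group acting on $P$ by automorphisms (and hence by isometries). Consider the following statements: (i) $G$ acts metrically properly on $P$. (ii) $G$ acts properly on $P$, meaning that for every compact $C\subseteq P$ the set $\{g\in G: g(C)\cap C\ne\emptyset\}$ is finite. (iii) For all vertices $v$ of $P$, the stabiliser $G_v$ is a finite group. (iv) $G$ acts properly discontinuously on $P$. (v) The homomorphism $h:G\to\mathrm{Aut}(P)$ given by the action has finite kernel and $h(G)$ is a discrete subgroup of $\mathrm{Aut}(P)\le\mathrm{Isom}(P)$ with the compact open topology (equivalently, the topology of pointwise convergence). Then, with the trees not assumed to be locally finite, (i) implies (ii); (ii), (iii) and (iv) are equivalent; and (iv) implies (v). Moreover the implications (i) $\Rightarrow$ (ii) and (iv) $\Rightarrow$ (v) are strict: there exist such $P$ and $G$ satisfying (ii) but not (i), and there exist such $P$ and $G$ satisfying (v) but not (iv).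
   Context: Trees are simplicial trees with the path metric, not necessarily locally finite. The product $P$ carries the obvious cube complex structure and the $\ell_2$ product metric; $\mathrm{Aut}(P)$ is the group of automorphisms preserving the cube complex structure (possibly permuting factors). Metrically properly: for every bounded $C\subseteq P$ the set $\{g\in G: g(C)\cap C\neq\emptyset\}$ is finite. Properly discontinuously: every point $x\in P$ has an open neighbourhood $U$ such that $\{g\in G: U\cap g(U)\neq\emptyset\}$ is finite. The compact open topology on $\mathrm{Isom}(P)$ has as sub-basis the sets $\{f\in\mathrm{Isom}(P): f(K)\subseteq U\}$ for $K$ compact and $U$ open in $P$. *)

(* Defs.v *)
From HB Require Import structures.
From mathcomp Require Import all_boot all_order all_algebra.
From mathcomp Require Import all_classical all_reals all_analysis.
From mathcomp Require Import ring.

Set Implicit Arguments.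
Unset Strict Implicit.
Unset Printing Implicit Defensive.

Import Order.TTheory GRing.Theory Num.Theory.

Local Open Scope classical_set_scope.
Local Open Scope ring_scope.

(* A (simplicial) tree: a nonempty connected simple graph without cycles, with
   no restriction on the cardinality of its vertex set or on its valencies.
   In [path.ucycle] the one- and two-vertex "cycles" [:: u] and [:: u; v] are
   allowed, whence the bound on the size. *)
Record tree := Tree {
  vert :> eqType;
  adj : rel vert;
  tree_nonempty : exists v : vert, True;
  adj_sym : symmetric adj;
  adj_irr : irreflexive adj;
  adj_connected : forall u v : vert, exists p, path adj u p /\ last u p = v;
  adj_acyclic : forall c : seq vert, ucycle adj c -> (size c <= 2)%N
}.

Section Realization.
Context {R : realType}.

(* The vertices (u = v) and the edges of T *)
Definition simplex (T : tree) (u v : T) : bool := (u == v) || adj u v.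

(* Barycentric coordinates of the point (1 - t) u + t v *)
Definition bary (T : tree) (u v : T) (t : R) : T -> R :=
  fun w => (1 - t) * (w == u)%:R + t * (w == v)%:R.

(* Points of the geometric realization, given by barycentric coordinates *)
Definition is_point (T : tree) (x : T -> R) : Prop :=
  exists u v t, [/\ simplex u v, 0 <= t <= 1 & x = bary u v t].

End Realization.

Definition realization (R : realType) (T : tree) : Type :=
  {x : T -> R | `[< is_point x >]}.

HB.instance Definition _ (R : realType) (T : tree) :=
  Choice.copy (realization R T) {x : T -> R | `[< is_point x >]}.

Section Realization.
Context {R : realType}.

Lemma vertex_subproof (T : tree) (v : T) :
  `[< is_point (bary v v 0 : T -> R) >].
Proof.
by apply/asboolP; exists v, v, 0; split; rewrite // ?/simplex ?eqxx ?lexx ?ler01.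
Qed.

Definition vertex (T : tree) (v : T) : realization R T :=
  exist _ (bary v v 0) (vertex_subproof v).

(* The closed cell of the realization spanned by a simplex *)
Definition cell (T : tree) (u v : T) : set (realization R T) :=
  [set x | exists2 t, 0 <= t <= 1 & sval x = bary u v t].

(* [chain x y l]: there is a piecewise linear path of length l from x to y,
   each linear piece staying in a closed edge; edges have length 1. *)
Inductive chain (T : tree) : realization R T -> realization R T -> R -> Prop :=
| chain_nil x : chain x x 0
| chain_cons x y z (u v : T) s t l :
    adj u v -> 0 <= s <= 1 -> 0 <= t <= 1 ->
    sval x = bary u v s -> sval y = bary u v t ->
    chain y z l -> chain x z (`|s - t| + l).

Definition path_dist (T : tree) (x y : realization R T) : R :=
  inf [set l | chain x y l].

Section PathMetric.
Variable T : tree.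
Implicit Types (x y z : realization R T) (u v : T).

Lemma chain_ge0 x y l : chain x y l -> 0 <= l.
Proof. by elim=> // *; rewrite addr_ge0. Qed.

Lemma chain_trans x y z l m : chain x y l -> chain y z m -> chain x z (l + m).
Proof.
elim=> [a|a b c u v s t k uv hs ht ea eb _ IH /IH h]; first by rewrite add0r.
by rewrite -addrA; exact: chain_cons ea eb h.
Qed.

Lemma chain_sym x y l : chain x y l -> chain y x l.
Proof.
elim=> [a|a b c u v s t k uv hs ht ea eb _ IH]; first exact: chain_nil.
rewrite addrC; apply: chain_trans IH _.
by rewrite -[`|_|]addr0 distrC; exact: chain_cons eb ea (chain_nil _).
Qed.

Lemma chain_lip x y l w : chain x y l -> `|sval x w - sval y w| <= l.
Proof.
elim=> [a|a b c u v s t k uv hs ht ea eb _ IH]; first by rewrite subrr normr0.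
apply: le_trans (ler_distD (sval b w) _ _) _; rewrite lerD// ea eb /bary.
have -> : (1 - s) * (w == u)%:R + s * (w == v)%:R -
  ((1 - t) * (w == u)%:R + t * (w == v)%:R) =
  (s - t) * ((w == v)%:R - (w == u)%:R) by ring.
rewrite normrM ler_piMr//.
by case: (w == v); case: (w == u);
  rewrite ?subrr ?subr0 ?sub0r ?normrN ?normr0 ?normr1.
Qed.

Lemma baryxx u (t : R) : bary u u t = bary u u 0.
Proof. by apply/funext => w; rewrite /bary; ring. Qed.

Lemma bary0 u v : bary u v 0 = bary u u 0 :> (T -> R).
Proof. by apply/funext => w; rewrite /bary; ring. Qed.

Lemma bary1 u v : bary u v 1 = bary v v 0 :> (T -> R).
Proof. by apply/funext => w; rewrite /bary; ring. Qed.

Lemma chain_to_vertex x : exists v l, chain x (vertex v) l.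
Proof.
case: x => f pf; have /asboolP[u [v [t [/orP[/eqP <-|uv] ht ef]]]] := pf.
  exists u, 0; rewrite (_ : exist _ _ _ = vertex u); first exact: chain_nil.
  by apply/val_inj; rewrite /= ef baryxx.
exists u, (`|t - 0| + 0); apply: (@chain_cons _ _ (vertex u) _ u v) => //.
- by rewrite lexx ler01.
- by rewrite /= (bary0 u v).
- exact: chain_nil.
Qed.

Lemma chain_vertices u v : exists l, chain (vertex u) (vertex v) l.
Proof.
have [p [+ <-]] := adj_connected u v; elim: p u => [|w p IH] u /=.
  by exists 0; exact: chain_nil.
case/andP=> uw /IH[l h]; exists (`|0 - 1| + l).
by apply: chain_cons uw _ _ _ _ h;
  rewrite /= ?lexx ?ler01 ?(bary0 u w) ?(bary1 u w).
Qed.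

Lemma chain_exists x y : [set l | chain x y l] !=set0.
Proof.
have [u [l hl]] := chain_to_vertex x; have [v [m hm]] := chain_to_vertex y.
have [k hk] := chain_vertices u v; exists (l + k + m).
exact: chain_trans (chain_trans hl hk) (chain_sym hm).
Qed.

Lemma chain_lb x y : has_lbound [set l | chain x y l].
Proof. by exists 0 => l /= /chain_ge0. Qed.

Lemma path_dist_ge0 x y : 0 <= path_dist x y.
Proof.
by apply: lb_le_inf; [exact: chain_exists | move=> l /= /chain_ge0].
Qed.

Lemma path_distxx x : path_dist x x = 0.
Proof.
apply/eqP; rewrite eq_le path_dist_ge0 andbT.
by apply: ge_inf; [exact: chain_lb | exact: chain_nil].
Qed.

Lemma path_dist_eq0 x y : path_dist x y = 0 -> x = y.
Proof.
move=> d0; apply/val_inj/funext => w /=; apply/eqP.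
rewrite -subr_eq0 -normr_le0 -d0.
by apply: lb_le_inf; [exact: chain_exists | move=> l /= /chain_lip].
Qed.

Lemma path_dist_sym x y : path_dist x y = path_dist y x.
Proof.
by rewrite /path_dist; congr inf; apply/seteqP; split=> l /= /chain_sym.
Qed.

Lemma path_dist_triangle y x z :
  path_dist x z <= path_dist x y + path_dist y z.
Proof.
rewrite -lerBlDr; apply: lb_le_inf; first exact: chain_exists.
move=> l /= hl; rewrite lerBlDr addrC -lerBlDr.
apply: lb_le_inf; first exact: chain_exists.
move=> m /= hm; rewrite lerBlDr addrC; apply: ge_inf; first exact: chain_lb.
exact: chain_trans hl hm.
Qed.

End PathMetric.
End Realization.

HB.instance Definition _ (R : realType) (T : tree) :=
  isMetric.Build R (realization R T) (@path_distxx R T) (@path_dist_eq0 R T)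
    (@path_dist_sym R T) (@path_dist_triangle R T).

(* An alias, so that the metric structure is the l2 one and not the one that the
   library puts on dependent products. *)
Definition tree_product (R : realType) (n : nat) (T : 'I_n -> tree) : Type :=
  forall i, realization R (T i).

HB.instance Definition _ (R : realType) n (T : 'I_n -> tree) :=
  Choice.copy (tree_product R T) (forall i, realization R (T i)).

Section ProductMetric.
Context {R : realType} (n : nat) (T : 'I_n -> tree).
Implicit Types x y z : tree_product R T.

Definition l2_dist x y : R := Num.sqrt (\sum_(i < n) mdist (x i) (y i) ^+ 2).

Lemma cauchy_schwarz_sum (a b : 'I_n -> R) :
  (\sum_i a i * b i) ^+ 2 <= (\sum_i a i ^+ 2) * (\sum_i b i ^+ 2).
Proof.
rewrite -subr_ge0 -(@pmulr_rge0 _ 2)//.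
suff -> : 2 * ((\sum_i a i ^+ 2) * (\sum_i b i ^+ 2) -
    (\sum_i a i * b i) ^+ 2) =
    \sum_i \sum_j (a i * b j - a j * b i) ^+ 2.
  by apply: sumr_ge0 => i _; apply: sumr_ge0 => j _; exact: sqr_ge0.
have E (c d : 'I_n -> R) :
  (\sum_i c i) * (\sum_i d i) = \sum_i \sum_j c i * d j.
  by rewrite mulr_suml; apply: eq_bigr => i _; rewrite mulr_sumr.
rewrite mulrBr expr2 {1}mulr2n mulrDl mul1r {2}[_ * (\sum_i b i ^+ 2)]mulrC.
rewrite !E mulr_sumr -big_split -sumrB/=; apply: eq_bigr => i _.
rewrite mulr_sumr -big_split -sumrB/=; apply: eq_bigr => j _.
by ring.
Qed.

Lemma l2_distxx x : l2_dist x x = 0.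
Proof.
by rewrite /l2_dist big1 ?sqrtr0// => i _; rewrite mdistxx expr0n.
Qed.

Lemma l2_dist_eq0 x y : l2_dist x y = 0 -> x = y.
Proof.
move=> /eqP; rewrite sqrtr_eq0 => d0.
apply/functional_extensionality_dep => i; apply: mdist_positivity.
apply/eqP; rewrite -sqrf_eq0 eq_le sqr_ge0 andbT; apply: le_trans d0.
rewrite (bigD1 i)//= lerDl; apply: sumr_ge0 => j _; exact: sqr_ge0.
Qed.

Lemma l2_dist_sym x y : l2_dist x y = l2_dist y x.
Proof.
by rewrite /l2_dist; congr Num.sqrt; apply: eq_bigr => i _; rewrite metric_sym.
Qed.

Lemma l2_dist_triangle y x z : l2_dist x z <= l2_dist x y + l2_dist y z.
Proof.
have sum_ge0 (a : 'I_n -> R) : 0 <= \sum_i a i ^+ 2.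
  by apply: sumr_ge0 => i _; exact: sqr_ge0.
have d0 u v : 0 <= l2_dist u v by exact: sqrtr_ge0.
rewrite -(@ler_pXn2r _ 2) ?nnegrE ?addr_ge0// sqrrD !sqr_sqrtr//.
pose a i := mdist (x i) (y i); pose b i := mdist (y i) (z i).
have ab : \sum_i a i * b i <= l2_dist x y * l2_dist y z.
  rewrite -sqrtrM// -[leLHS]ger0_norm.
    by rewrite -sqrtr_sqr ler_wsqrtr// cauchy_schwarz_sum.
  by apply: sumr_ge0 => i _; rewrite mulr_ge0// mdist_ge0.
apply: (@le_trans _ _ (\sum_i (a i + b i) ^+ 2)).
  apply: ler_sum => i _.
  by rewrite ler_pXn2r ?nnegrE ?addr_ge0 ?mdist_ge0// metric_triangle.
rewrite (eq_bigr (fun i => a i ^+ 2 + (a i * b i) *+ 2 + b i ^+ 2)); last first.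
  by move=> i _; rewrite sqrrD.
rewrite !big_split/=; apply: lerD => //; apply: lerD => //.
by rewrite mulr2n lerD.
Qed.

End ProductMetric.

HB.instance Definition _ (R : realType) n (T : 'I_n -> tree) :=
  isMetric.Build R (tree_product R T) (@l2_distxx R n T) (@l2_dist_eq0 R n T)
    (@l2_dist_sym R n T) (@l2_dist_triangle R n T).

Section Automorphisms.
Context {R : realType} {n : nat} {T : 'I_n -> tree}.
Local Notation P := (tree_product R T).
Implicit Types (C : set P) (f : P -> P).

Definition is_vertex (x : P) : Prop :=
  exists v : forall i, T i, x = (fun i => vertex (v i)).

Definition is_cube C : Prop :=
  exists u v : forall i, T i, (forall i, simplex (u i) (v i)) /\
    C = [set x : P | forall i, cell (u i) (v i) (x i)].

Definition cubical f : Prop :=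
  forall C, is_cube C -> is_cube (f @` C) /\
    {in C &, forall x y, mdist (f x) (f y) = mdist x y}.

(* Nothing forces an automorphism to respect the order of the factors, and
   only its restrictions to cubes are required to be isometric. *)
Definition Aut_product : set (P -> P) :=
  [set f : P -> P | exists g : P -> P,
    [/\ cancel f g, cancel g f, cubical f & cubical g]].

Definition Isom_product : set (P -> P) :=
  [set f : P -> P | bijective f /\ forall x y, mdist (f x) (f y) = mdist x y].

End Automorphisms.

Arguments Aut_product {R n} T.
Arguments Isom_product {R n} T.

Section Actions.
Context {R : realType} {n : nat} {T : 'I_n -> tree} {G : groupType}.
Local Notation P := (tree_product R T).
Implicit Types (h : G -> P -> P).

Record aut_action h : Prop := AutAction {
  aut_act1 : forall x, h 1%g x = x;
  aut_actM : forall g k x, h (g * k)%g x = h g (h k x);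
  aut_act_aut : forall g, Aut_product T (h g)
}.

Definition metric_bounded (C : set P) : Prop :=
  exists M : R, forall x y, C x -> C y -> mdist x y <= M.

Definition metrically_proper h : Prop :=
  forall C : set P, metric_bounded C ->
    finite_set [set g | (h g @` C) `&` C !=set0].

Definition proper_action h : Prop :=
  forall C : set P, compact C -> finite_set [set g | (h g @` C) `&` C !=set0].

Definition finite_vertex_stabilisers h : Prop :=
  forall v : P, is_vertex v -> finite_set [set g | h g v = v].

Definition properly_discontinuous h : Prop :=
  forall x : P, exists U : set P,
    open_nbhs x U /\ finite_set [set g | U `&` (h g @` U) !=set0].

(* The subspace topology that h(G) gets from Isom(P) is the one it gets from
   the space of all maps P -> P with the compact-open topology. *)
Definition finite_kernel_discrete_image h : Prop :=
  finite_set [set g | h g = id] /\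
  let hG : set {compact-open, P -> P} := range h in hG `<=` isolated hG.

End Actions.

(* Main.v *)
Require Import Defs.
From HB Require Import structures.
From mathcomp Require Import all_boot all_order all_algebra.
From mathcomp Require Import finmap.
From mathcomp Require Import all_classical all_reals all_analysis.
From mathcomp Require Import ring lra.

(* An automorphism is an isometry because it preserves the length of piecewise
   linear paths: a path that is 1-Lipschitz and, at each time and on each side,
   stays for a while in one cube has an image with the same Lipschitz bound.

   The implications between (i)-(v) all follow from one estimate.  Every point y
   has a barycentric coordinate at least 1/2 in each factor, at vertices forming
   a vertex w0 of the product, and coordinates are 1-Lipschitz.  If g x is at
   distance less than 1/2 from y, a cube containing g x must therefore contain
   w0, so g maps one of the finitely many vertices of a fixed cube around x to
   w0.  If vertex stabilisers are finite, only finitely many g do so; a compact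
   set is covered by finitely many small balls, and a neighbourhood of h(k) in
   the compact-open topology contains only finitely many h(g).

   Strictness: the free product of infinitely many groups of order two acts
   freely on its Cayley tree, and each generator moves the root by distance 1;
   an infinite group acts on the star whose leaves are its elements, fixing the
   centre, while the position of a single leaf determines the group element. *)

Set Implicit Arguments.
Unset Strict Implicit.
Unset Printing Implicit Defensive.

Import Order.TTheory GRing.Theory Num.Theory.

Local Open Scope classical_set_scope.
Local Open Scope ring_scope.

(** * From local to global Lipschitz bounds along a path *)

Section LocalLipschitz.
Variables (R : realType) (M : metricType R).

(** Let [c] be the supremum of the times in [0, 1] up to which the bound holds. The local bound to
    the left of [c] puts [c] itself in that set, and the one to the right would extend the set
    beyond [c] if [c < 1]. *)
Lemma local_lipschitz (phi : R -> M) (L : R) :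
    (forall t d, exists2 e, 0 < e & forall r, 0 <= r <= e ->
      mdist (phi t) (phi (t + d * r)) <= L * (`|d| * r)) ->
  mdist (phi 0) (phi 1) <= L.
Proof.
move=> loc; pose S := [set t | 0 <= t <= 1 /\ mdist (phi 0) (phi t) <= L * t].
have S0 : S 0 by rewrite /S/= lexx ler01 mdistxx mulr0.
have S1 : ubound S 1 by move=> t [/andP[]].
have supS : has_sup S by split; [exists 0 | exists 1].
set c := sup S.
have c0 : 0 <= c by apply: ub_le_sup => //; exists 1.
have c1 : c <= 1 by apply: ge_sup => //; exists 0.
have Sc : S c.
  have [e e0 le] := loc c (-1).
  have [s Ss sc] := sup_adherent e0 supS.
  have {}sc : c - e < s by [].
  have sc' : s <= c by apply: ub_le_sup => //; exists 1.
  have := le (c - s); rewrite (_ : c + -1 * (c - s) = s); last by ring.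
  move=> /(_ _)/wrap[|cs]; first by apply/andP; split; lra.
  case: Ss => _ Ss; split; first by rewrite c0.
  apply: le_trans (metric_triangle _ (phi s) _) _.
  rewrite [X in _ + X]metric_sym; move: cs; rewrite normrN1 mul1r mulrBr => cs.
  lra.
suff c1' : 1 <= c by case: Sc; rewrite (_ : c = 1) ?mulr1//; apply/le_anti/andP.
rewrite leNgt; apply/negP => cl1.
have [e e0 le] := loc c 1.
pose r := Num.min e (1 - c).
have r0 : 0 < r by rewrite lt_min e0 subr_gt0.
suff : S (c + r) by move/(ub_le_sup (ex_intro _ 1 S1)); rewrite -/c; lra.
have re : r <= e by rewrite ge_min lexx.
have rc : r <= 1 - c by rewrite ge_min lexx orbT.
split; first by apply/andP; split; lra.
have := le r; rewrite mul1r normr1 mul1r (ltW r0) re => /(_ isT) cr.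
apply: le_trans (metric_triangle _ (phi c) _) _.
case: Sc => _ Sc; rewrite mulrDr; lra.
Qed.

End LocalLipschitz.

(** * Chains as paths that locally stay in one cell *)

Section CellularPaths.
Variables (R : realType) (T : tree).
Implicit Types (x y z : realization R T) (gamma : R -> realization R T).

Lemma mdist_chain x y l : chain x y l -> mdist x y <= l.
Proof. by move=> xy; apply: ge_inf => //; exact: chain_lb. Qed.

(* The direction [d] is an arbitrary real, not only 1 or -1, so that paths run at
   different speeds in the different factors still stay in a cube locally. *)
Definition cellular_path gamma : Prop :=
  (forall s t, mdist (gamma s) (gamma t) <= `|s - t|) /\
  (forall t d, exists2 e, 0 < e & exists u v, simplex u v /\
    forall r, 0 <= r <= e -> cell u v (gamma (t + d * r))).

Lemma cellular_path_cst x : cellular_path (fun=> x).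
Proof.
split=> [s t|t d]; first by rewrite mdistxx.
have /asboolP[u [v [p [uv hp xE]]]] := valP x.
by exists 1 => //; exists u, v; split=> // r _; exists p.
Qed.

Lemma clamp_lipschitz (a b : R) :
  `|Num.max 0 (Num.min 1 a) - Num.max 0 (Num.min 1 b)| <= `|a - b|.
Proof.
wlog ab : a b / a <= b.
  by move=> W; case/orP: (le_total a b) => /W //; rewrite distrC [leRHS]distrC.
rewrite [leRHS]distrC [leRHS]ger0_norm ?subr_ge0//.
rewrite ler_norml.
by case: (leP 1 a) => ?; case: (leP 1 b) => ?; case: (leP (0 : R) 1) => ?;
  case: (leP 0 a) => ?; case: (leP 0 b) => ?; apply/andP; split; lra.
Qed.

(** The parameter moves at unit speed from [s] in the direction of [t], whose sign is [c]. Clamping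
    it to [0, 1] defines the path at all real times. *)
Lemma edge_path x y (u v : T) s t : simplex u v -> 0 <= s <= 1 -> 0 <= t <= 1 ->
    sval x = bary u v s -> sval y = bary u v t ->
  exists gamma, [/\ cellular_path gamma, gamma 0 = x & gamma `|s - t| = y].
Proof.
move=> uv hs ht xE yE.
have uvE : u = v \/ adj u v by case/orP: uv => [/eqP|]; [left|right].
pose c : R := if s <= t then 1 else -1.
have cN : `|c| = 1 by rewrite /c; case: ifP; rewrite ?normrN ?normr1.
pose p a := Num.max 0 (Num.min 1 (s + c * a)).
have p01 a : 0 <= p a <= 1.
  by rewrite /p le_max lexx ge_max ler01 ge_min lexx.
have pt a : `[< is_point (bary u v (p a)) >].
  by apply/asboolP; exists u, v, (p a).
have pE a : 0 <= s + c * a <= 1 -> p a = s + c * a.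
  by case/andP=> a0 a1; rewrite /p min_r// max_r.
pose g a : realization R T := exist _ (bary u v (p a)) (pt a).
exists g; split.
- split=> [a b|a d]; last first.
    by exists 1 => //; exists u, v; split=> // r _; exists (p (a + d * r)).
  have le : `|p a - p b| <= `|a - b|.
    apply: le_trans (clamp_lipschitz _ _) _.
    by rewrite opprD addrACA subrr add0r -mulrBr normrM cN mul1r.
  (* A degenerate simplex has no edge to build a chain on, but all its points coincide. *)
  case: uvE => [E|adjuv].
    rewrite (_ : g a = g b) ?mdistxx//.
    by apply/val_inj; rewrite /= -E !(baryxx u (p _)).
  apply: le_trans le; rewrite -[leRHS]addr0; apply: mdist_chain.
  exact: chain_cons adjuv (p01 a) (p01 b) _ _ (chain_nil _).
- by apply/val_inj; rewrite /= pE mulr0 addr0// -xE.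
- have cst : s + c * `|s - t| = t.
    rewrite /c; case: leP => st.
      by rewrite distrC ger0_norm ?subr_ge0// mul1r; ring.
    by rewrite gtr0_norm ?subr_gt0//; ring.
  by apply/val_inj; rewrite /= pE cst// -yE.
Qed.

Lemma ray_stays_below (t d a : R) : t <= a -> (t = a -> d <= 0) ->
  exists2 e, 0 < e & forall r, 0 <= r <= e -> t + d * r <= a.
Proof.
move=> ta tad; have [ta'|] := ltP t a; last first.
  move=> at_; have tE : t = a by apply/le_anti/andP.
  exists 1 => // r /andP[r0 _]; rewrite tE gerDl.
  by rewrite mulr_le0_ge0// tad.
have d1 : 0 < `|d| + 1 by rewrite ltr_wpDl.
(* Adding 1 keeps the denominator positive when [d = 0]. *)
exists ((a - t) / (`|d| + 1)); first by rewrite divr_gt0// subr_gt0.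
move=> r /andP[r0]; rewrite ler_pdivlMr// => hr; rewrite -lerBrDl.
apply: le_trans hr; rewrite mulrC ler_wpM2l//.
by rewrite (le_trans (ler_norm d))// lerDl.
Qed.

(** Any ray of times stays on one side of [a] for a while, so a single one of the two paths provides
    the cell. The Lipschitz bound across [a] is the triangle inequality through the common point. *)
Lemma cellular_path_glue (g1 g2 : R -> realization R T) (a : R) :
    cellular_path g1 -> cellular_path g2 -> g1 a = g2 0 ->
  cellular_path (fun t => if t <= a then g1 t else g2 (t - a)).
Proof.
move=> [lip1 loc1] [lip2 loc2] g12; set g := fun t => _.
have gl t : t <= a -> g t = g1 t by rewrite /g => ->.
have gr t : a <= t -> g t = g2 (t - a).
  rewrite /g; case: ifP => // ta at_; have -> : t = a by apply/le_anti/andP.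
  by rewrite subrr.
split=> [s t|t d].
  wlog st : s t / s <= t.
    move=> W; case/orP: (le_total s t) => /W //.
    by rewrite metric_sym distrC.
  have [ta|/ltW at_] := leP t a; first by rewrite !gl ?(le_trans st ta).
  have [sa|/ltW as_] := leP s a; last first.
    rewrite (gr _ as_) (gr _ at_).
    apply: le_trans (lip2 _ _) _.
    by rewrite opprB addrA subrK.
  rewrite (gl _ sa) (gr _ at_).
  apply: le_trans (metric_triangle _ (g1 a) _) _.
  have h1 := lip1 s a; have := lip2 0 (t - a); rewrite -g12 => h2.
  apply: le_trans (lerD h1 h2) _.
  rewrite !ler0_norm ?sub0r; lra.
(* The second case is the first one reflected, so that [ray_stays_below] serves for both sides. *)
have [low|high] : (t <= a /\ (t = a -> d <= 0)) \/
    (- t <= - a /\ (- t = - a -> - d <= 0)).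
  case: (ltgtP t a) => ta; [left|right|].
  - by split=> // E; rewrite E ltxx in ta.
  - by split=> [|/oppr_inj E]; [lra|rewrite E ltxx in ta].
  - by case: (leP d 0) => d0; [left|right]; split=> //; lra.
- have [e1 e10 [u [v [uv h1]]]] := loc1 t d.
  have [e2 e20 h2] := ray_stays_below low.1 low.2.
  exists (Num.min e1 e2); first by rewrite lt_min e10.
  exists u, v; split=> // r /andP[r0]; rewrite le_min => /andP[re1 re2].
  by rewrite gl; [apply: h1|apply: h2]; apply/andP.
- have [e1 e10 [u [v [uv h1]]]] := loc2 (t - a) d.
  have [e2 e20 h2] := ray_stays_below high.1 high.2.
  exists (Num.min e1 e2); first by rewrite lt_min e10.
  exists u, v; split=> // r /andP[r0]; rewrite le_min => /andP[re1 re2].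
  rewrite gr; first by rewrite addrAC; apply: h1; apply/andP.
  by have := h2 r; rewrite r0 re2 => /(_ isT); lra.
Qed.

Lemma chain_path x y l : chain x y l ->
  exists gamma, [/\ cellular_path gamma, gamma 0 = x & gamma l = y].
Proof.
elim=> {x y l} [x|x y z u v s t l uv hs ht xE yE yz [g2 [cg2 g20 g2l]]].
  by exists (fun=> x); split=> //; exact: cellular_path_cst.
have suv : simplex u v by rewrite /simplex uv orbT.
have [g1 [cg1 g10 g1a]] := edge_path suv hs ht xE yE.
have l0 := chain_ge0 yz.
have glued : g1 `|s - t| = g2 0 by rewrite g1a.
exists (fun r => if r <= `|s - t| then g1 r else g2 (r - `|s - t|)).
split; first exact: cellular_path_glue.
  by rewrite normr_ge0.
case: ifP; last by rewrite addrAC subrr add0r.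
(* The final time falls in the first branch only if [l = 0], and then [g2] starts at its
   endpoint. *)
rewrite gerDl => l0'; have l00 : l = 0 by apply/le_anti/andP.
by rewrite -g2l l00 addr0.
Qed.

End CellularPaths.

Lemma bounded_below_ord (R : realType) n (e : 'I_n -> R) : (forall i, 0 < e i) ->
  exists2 d, 0 < d & forall i, d <= e i.
Proof.
move=> e0; exists (\big[Num.min/1]_i e i); first by apply: lt_bigmin.
by move=> i; exact: bigmin_le_cond.
Qed.

(** * Cubical maps are 1-Lipschitz, and automorphisms are isometries *)

Section CubicalMaps.
Variables (R : realType) (n : nat) (T : 'I_n -> tree).
Local Notation P := (tree_product R T).
Implicit Types (x y : P) (f : P -> P).

Lemma mdist_prodE x y : mdist x y = Num.sqrt (\sum_i mdist (x i) (y i) ^+ 2).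
Proof. by []. Qed.

(** Traverse the chain in factor [i] at speed [l i], so that all chains take the time interval
    [0, 1]. The product path has the right-hand side as Lipschitz constant and locally stays in a
    cube, where [f] is isometric, so [local_lipschitz] applies to its image. *)
Lemma cubical_le_chains f x y (l : 'I_n -> R) : cubical f ->
    (forall i, chain (x i) (y i) (l i)) ->
  mdist (f x) (f y) <= Num.sqrt (\sum_i l i ^+ 2).
Proof.
move=> cf xy; have l0 i := chain_ge0 (xy i).
have path i := cid (chain_path (xy i)).
pose g i := sval (path i); pose G (t : R) : P := fun i => g i (t * l i).
have lip i : cellular_path (g i) by case: (svalP (path i)).
have -> : x = G 0.
  apply/functional_extensionality_dep => i; rewrite /G mul0r.
  by case: (svalP (path i)).
have -> : y = G 1.
  apply/functional_extensionality_dep => i; rewrite /G mul1r.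
  by case: (svalP (path i)).
set L := Num.sqrt _.
apply: (@local_lipschitz _ _ (f \o G) L) => t d.
(* Direction [d] for the common time is direction [d * l i] in factor [i]; the least of the [n]
   durations works for all factors. *)
have loc i := cid2 ((lip i).2 (t * l i) (d * l i)).
have [e e0 le] : exists2 e, 0 < e & forall i, e <= s2val (loc i).
  by apply: bounded_below_ord => i; exact: (s2valP (loc i)).
have uv i : {uv | simplex uv.1 uv.2 /\ forall r, 0 <= r <= s2val (loc i) ->
    cell uv.1 uv.2 (g i (t * l i + d * l i * r))}.
  by apply: cid; have [u [v h]] := s2valP' (loc i); exists (u, v).
pose C := [set z : P | forall i, cell (sval (uv i)).1 (sval (uv i)).2 (z i)].
have cubeC : is_cube C.
  exists (fun i => (sval (uv i)).1), (fun i => (sval (uv i)).2).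
  by split=> // i; case: (svalP (uv i)).
have GC r : 0 <= r <= e -> C (G (t + d * r)).
  case/andP=> r0 re i; have [_] := svalP (uv i).
  move=> /(_ r); rewrite r0 (le_trans re)// => /(_ isT).
  by rewrite /G mulrDl mulrAC.
exists e => // r hr.
have /andP[r0 _] := hr.
have -> : mdist ((f \o G) t) ((f \o G) (t + d * r)) = mdist (G t) (G (t + d * r)).
  apply: (cf C cubeC).2; rewrite inE; last exact: GC.
  by have := GC 0; rewrite mulr0 addr0; apply; rewrite lexx ltW.
have -> : L * (`|d| * r) = Num.sqrt (\sum_i (`|d| * r * l i) ^+ 2).
  rewrite (eq_bigr (fun i => (`|d| * r) ^+ 2 * l i ^+ 2)); last first.
    by move=> i _; rewrite exprMn.
  rewrite -mulr_sumr sqrtrM ?sqr_ge0// sqrtr_sqr mulrC.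
  by rewrite (@ger0_norm _ (`|d| * r)) ?mulr_ge0.
rewrite mdist_prodE ler_wsqrtr// ler_sum// => i _.
rewrite ler_pXn2r ?nnegrE ?mdist_ge0// ?mulr_ge0//.
apply: le_trans ((lip i).1 _ _) _.
by rewrite -mulrBl normrM (ger0_norm (l0 i)) opprD addrA subrr sub0r normrN
  normrM (ger0_norm r0).
Qed.

Lemma cubical_lipschitz f x y : cubical f -> mdist (f x) (f y) <= mdist x y.
Proof.
move=> cf; set a := mdist (f x) (f y).
have a0 : 0 <= a by exact: mdist_ge0.
rewrite mdist_prodE -(ger0_norm a0) -sqrtr_sqr ler_wsqrtr//.
(* Chains only approximate the distance. For [e <= 1], (m + e)^2 <= m^2 + e (2 m + 1), so an excess
   below [e] in each factor costs at most [e * K] in the sum of squares. *)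
set S := \sum_i _; pose K := \sum_i (2 * mdist (x i) (y i) + 1).
have K0 : 0 <= K.
  by apply: sumr_ge0 => i _; rewrite addr_ge0// mulr_ge0// mdist_ge0.
suff H e : 0 < e -> e <= 1 -> a ^+ 2 <= S + e * K.
  apply/ler_addgt0Pr => e e0.
  have K1 : 0 < K + 1 by rewrite ltr_wpDl.
  pose d := Num.min 1 (e / (K + 1)).
  have d0 : 0 < d by rewrite lt_min ltr01 divr_gt0.
  have d1 : d <= 1 by rewrite ge_min lexx.
  apply: le_trans (H d d0 d1) _; rewrite lerD2l.
  have de : d <= e / (K + 1) by rewrite ge_min lexx orbT.
  move: de; rewrite ler_pdivlMr//; nra.
move=> e0 e1.
have ex i : {l | chain (x i) (y i) l & l < mdist (x i) (y i) + e}.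
  apply: cid2; have := @inf_adherent _ [set l | chain (x i) (y i) l] _ e0.
  case; first by split; [exact: chain_exists | exact: chain_lb].
  by move=> l xyl le; exists l.
pose l i := s2val (ex i).
have al : a <= Num.sqrt (\sum_i l i ^+ 2).
  exact: cubical_le_chains (fun i => s2valP (ex i)).
apply: (@le_trans _ _ (\sum_i l i ^+ 2)).
  rewrite -[leRHS]sqr_sqrtr ?ler_pXn2r ?nnegrE ?sqrtr_ge0//.
  by apply: sumr_ge0 => i _; rewrite sqr_ge0.
rewrite mulr_sumr -big_split/=; apply: ler_sum => i _.
have l0 : 0 <= l i := chain_ge0 (s2valP (ex i)).
have : l i < mdist (x i) (y i) + e := s2valP' (ex i).
have := mdist_ge0 (x i) (y i).
move: (mdist _ _) (l i) l0 => m k k0 m0 km; nra.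
Qed.

(** Both the map and its inverse are cubical, hence 1-Lipschitz. *)
Lemma Aut_product_isom : Aut_product T `<=` Isom_product (R := R) T.
Proof.
move=> f [g [fK gK cf cg]]; split; first by exists g.
move=> x y; apply/le_anti; rewrite cubical_lipschitz//=.
by rewrite -{1}(fK x) -{1}(fK y) cubical_lipschitz.
Qed.

End CubicalMaps.

(** * Finite covers of compact sets by balls *)

Section CompactCover.
Variables (R : realType) (M : metricType R).

(* The library states [compact_cover] for pointed spaces only. *)
Lemma compact_open_cover (C : set M) : compact C -> cover_compact C.
Proof.
move=> cC; have [->|/set0P[p _]] := eqVneq C set0.
  by move=> I D f _ _; exists fset0.
pose M' : ptopologicalType :=
  HB.pack (M : Type) (isPointed.Build (M : Type) p) (Topological.class M).
by move: cC; rewrite -(@compact_cover M').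
Qed.

Lemma compact_ball_cover (C : set M) (e : M -> R) :
    compact C -> (forall x, 0 < e x) ->
  exists s : {fset M}, [set` s] `<=` C /\
    forall z, C z -> exists2 x, x \in s & mdist x z < e x.
Proof.
move=> cC e0; pose U x := (ball x (e x))°.
have Ux x : open_nbhs x (U x) := open_nbhs_ball x (PosNum (e0 x)).
have oU x : C x -> open (U x) by move=> _; have [] := Ux x.
have CU : C `<=` cover C U.
  by move=> x Cx; exists x => //; have [] := Ux x.
have /(_ _ _ _ oU CU)[s sC' sC] := compact_open_cover cC.
exists s; split=> [x xs|z /sC[x xs /interior_subset]].
  by have /set_mem := sC' x xs.
by rewrite ballEmdist/=; exists x.
Qed.

End CompactCover.

(** * Compact-open topology and pointwise convergence *)

Section FunctionTopologies.
Variables (U V : topologicalType).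

Lemma evaluation_compact_open (f : {compact-open, U -> V}) (x : U) (W : set V) :
  nbhs (f x) W -> nbhs f [set g : {compact-open, U -> V} | W (g x)].
Proof.
move=> fW; apply: (@filterS _ _ _ [set g | g @` [set x] `<=` W°]).
  by move=> g gW; apply: interior_subset; apply: gW; exists x.
apply: open_nbhs_nbhs; split.
  by apply: compact_open_open; [exact: compact_set1 | exact: open_interior].
by move=> _ [_ -> <-].
Qed.

Lemma evaluation_ptws (f : {ptws U -> V}) (x : U) (W : set V) :
  nbhs (f x) W -> nbhs f [set g : {ptws U -> V} | W (g x)].
Proof. exact: (@proj_continuous U (fun=> V) x f). Qed.

(** The pointwise topology is the coarsest one making all evaluations continuous, and these are
    continuous for the compact-open topology because points are compact. *)
Lemma compact_open_finer_ptws (f : U -> V) :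
  nbhs (f : {ptws U -> V}) `<=` nbhs (f : {compact-open, U -> V}).
Proof.
suff : nbhs (f : {compact-open, U -> V}) --> (f : {ptws U -> V}) by [].
apply/cvg_sup => x; apply/cvg_image.
  (* Evaluation at [x] is onto, thanks to the constant maps. *)
  by rewrite eqEsubset; split=> // v _; exists (cst v).
move=> W /evaluation_compact_open fW; exists (@^~ x @^-1` W) => //.
by rewrite eqEsubset; split=> [_ [g gW <-]//|v Wv]; exists (cst v).
Qed.

End FunctionTopologies.

(** * The two topologies agree on isometries *)

Section IsometryTopologies.
Variables (R : realType) (n : nat) (T : 'I_n -> tree).
Local Notation P := (tree_product R T).

(** Isometries are equicontinuous: an isometry close to [f] at the finitely many centres of a fine
    cover of [K] is close to [f] on all of [K]. *)
Lemma Isom_compact_open_ptws (f : P -> P) : Isom_product T f ->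
  within (Isom_product T) (nbhs (f : {compact-open, P -> P})) =
  within (Isom_product T) (nbhs (f : {ptws P -> P})).
Proof.
move=> If; apply/seteqP; split=> W; last exact: compact_open_finer_ptws.
pose F := within (Isom_product T) (nbhs (f : {ptws P -> P})).
have FF : Filter F by apply: within_filter; exact: (@nbhs_filter {ptws P -> P} f).
suff FE : F --> (f : {compact-open, P -> P}).
  move=> fW; have : F [set g | Isom_product T g -> W g] := FE _ fW.
  by apply: (@filterS _ (nbhs (f : {ptws P -> P}))) => g Wg Ig; exact: Wg.
apply/compact_open_cvgP => K O cK oO fKO.
have ex x : {e | 0 < e & K x -> ball (f x) e `<=` O}.
  (* The radius 1 outside [K] is a dummy, since the centres of the cover lie in [K]. *)
  apply: cid2; have [Kx|nKx] := pselect (K x); last by exists 1.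
  have /nbhs_ballP[e e0 fxO] : nbhs (f x) O.
    by apply: open_nbhs_nbhs; split=> //; apply: fKO; exists x.
  by exists e.
pose e x := s2val (ex x); have e0 x : 0 < e x := s2valP (ex x).
have eO x : K x -> ball (f x) (e x) `<=` O := s2valP' (ex x).
have [|s [sK' sK]] := @compact_ball_cover _ _ K (fun x => e x / 2) cK.
  by move=> x; rewrite divr_gt0.
have near_s : nbhs (f : {ptws P -> P})
    (\bigcap_(x in [set` s]) [set g : {ptws P -> P} | ball (f x) (e x / 2) (g x)]).
  apply: filter_bigI => x _; apply: evaluation_ptws.
  by apply: nbhsx_ballx; rewrite divr_gt0.
apply: filterS near_s => g gs [_ Ig] _ [z /sK[x xs xz] <-].
apply: (eO x); first exact: sK'.
have := gs x xs; rewrite /= !ballEmdist/= => fgx.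
apply: le_lt_trans (metric_triangle _ (g x) _) _.
by rewrite Ig (splitr (e x)) ltrD.
Qed.

End IsometryTopologies.

(** * Barycentric coordinates and the vertices of cubes *)

Section Vertices.
Variable R : realType.

Lemma coordinate_lipschitz (T : tree) (x y : realization R T) (w : T) :
  `|sval x w - sval y w| <= mdist x y.
Proof.
by apply: lb_le_inf => [|l /= /chain_lip]; [exact: chain_exists | exact].
Qed.

Lemma half_coordinate (T : tree) (x : realization R T) :
  exists w, 1 / 2 <= sval x w.
Proof.
have /asboolP[u [v [t [_ /andP[t0 t1] ->]]]] := valP x.
have [t2|t2] := leP t (1 / 2); [exists u|exists v]; rewrite /bary eqxx.
  by case: (u == v) => /=; rewrite ?mulr1 ?mulr0; lra.
by case: (v == u) => /=; rewrite ?mulr1 ?mulr0; lra.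
Qed.

Lemma cell_support (T : tree) (u v : T) (x : realization R T) w :
  cell u v x -> 0 < sval x w -> w = u \/ w = v.
Proof.
case=> t _ ->; rewrite /bary.
have [->|_] := eqVneq w u; first by left.
have [->|_] := eqVneq w v; first by right.
by rewrite !mulr0 addr0 ltxx.
Qed.

Lemma vertexE (T : tree) (u w : T) :
  sval (vertex u : realization R T) w = (w == u)%:R.
Proof. by rewrite /= /bary subr0 mul1r mul0r addr0. Qed.

Lemma vertex_cell (T : tree) (u v w : T) :
  w = u \/ w = v -> cell u v (vertex w : realization R T).
Proof.
case=> ->; [exists 0|exists 1]; rewrite ?lexx ?ler01//=; first by rewrite (bary0 u v).
by rewrite (bary1 u v).
Qed.

Lemma cellxx (T : tree) (u : T) (x : realization R T) : cell u u x -> x = vertex u.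
Proof. by case=> t _ xE; apply/val_inj; rewrite /= xE baryxx. Qed.

Variables (n : nat) (T : 'I_n -> tree).
Local Notation P := (tree_product R T).
Implicit Types (x y : P) (f : P -> P).

Definition product_vertex (v : forall i, T i) : P := fun i => vertex (v i).

Lemma mdist_coord x y i : mdist (x i) (y i) <= mdist x y.
Proof.
rewrite mdist_prodE -[leLHS]ger0_norm ?mdist_ge0// -sqrtr_sqr ler_wsqrtr//.
by rewrite (bigD1 i)//= lerDl sumr_ge0// => j _; exact: sqr_ge0.
Qed.

Lemma point_in_cube x : exists u v : forall i, T i,
  (forall i, simplex (u i) (v i)) /\ forall i, cell (u i) (v i) (x i).
Proof.
have uv i : {uv : T i * T i | simplex uv.1 uv.2 /\ cell uv.1 uv.2 (x i)}.
  apply: cid; have /asboolP[u [v [t [uv ht xE]]]] := valP (x i).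
  by exists (u, v); split=> //; exists t.
exists (fun i => (sval (uv i)).1), (fun i => (sval (uv i)).2).
by split=> i; have [] := svalP (uv i).
Qed.

Lemma vertex_cube (v : forall i, T i) : is_cube [set product_vertex v].
Proof.
exists v, v; split=> [i|]; first by rewrite /simplex eqxx.
apply/seteqP; split=> [_ -> i|x vx]; first by apply: vertex_cell; left.
by apply/functional_extensionality_dep => i; exact: cellxx.
Qed.

(** A vertex is a one-point cube, so its image is a one-point cube, and every cube contains a
    vertex. *)
Lemma cubical_vertex f x : cubical f -> is_vertex x -> is_vertex (f x).
Proof.
move=> cf [v ->]; have [[u [w [_ uwE]]] _] := cf _ (vertex_cube v).
exists u; suff : (f @` [set product_vertex v]) (product_vertex u).
  by case=> _ ->.
by rewrite uwE => i; apply: vertex_cell; left.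
Qed.

Lemma finite_cube_vertices (u v : forall i, T i) :
  finite_set [set w : forall i, T i | forall i, w i = u i \/ w i = v i].
Proof.
(* A corner of the cube is determined by one bit per factor. *)
pose V (b : {ffun 'I_n -> bool}) i := if b i then u i else v i.
apply: (@sub_finite_set _ _ (V @` setT)); last first.
  by apply: finite_image; exact: finite_finset.
move=> w uvw; exists [ffun i => w i == u i] => //.
apply/functional_extensionality_dep => i; rewrite /V ffunE.
by case: eqP => [->//|wu]; case: (uvw i).
Qed.

End Vertices.

Arguments product_vertex {R n T} v.

(** * Implications between the finiteness conditions on an action *)

Section ProperActions.
Variables (R : realType) (n : nat) (T : 'I_n -> tree) (G : groupType).
Local Notation P := (tree_product R T).
Variable h : G -> P -> P.
Hypothesis hP : aut_action h.

Lemma act_isom g x y : mdist (h g x) (h g y) = mdist x y.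
Proof. by have [_ ->] := Aut_product_isom (aut_act_aut hP g). Qed.

Lemma act_cubical g : cubical (h g).
Proof. by have [k []] := aut_act_aut hP g. Qed.

Lemma actVK g x : h g^-1%g (h g x) = x.
Proof. by rewrite -(aut_actM hP) mulVg (aut_act1 hP). Qed.

(** If nonempty, this set is a left coset of the stabiliser of [x]. *)
Lemma finite_transporter x y : finite_set [set g | h g x = x] ->
  finite_set [set g | h g x = y].
Proof.
move=> fin; have [->|/set0P[g0 g0x]] := eqVneq [set g | h g x = y] set0 => //.
apply: (@sub_finite_set _ _ ((fun g => (g0 * g)%g) @` [set g | h g x = x])).
  move=> g /= gx; exists (g0^-1 * g)%g; last by rewrite mulgA mulgV mul1g.
  by rewrite /= (aut_actM hP) gx -g0x actVK.
exact: finite_image.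
Qed.

Lemma finite_near x y : finite_vertex_stabilisers h ->
  finite_set [set g | mdist (h g x) y < 1 / 2].
Proof.
move=> stab; have w i := cid (half_coordinate (y i)).
pose w0 i := sval (w i).
have [u [v [uv xuv]]] := point_in_cube x.
pose C := [set z : P | forall i, cell (u i) (v i) (z i)].
have cubeC : is_cube C by exists u, v.
pose D := [set w : forall i, T i | forall i, w i = u i \/ w i = v i].
apply: (@sub_finite_set _ _
  (\bigcup_(w in D) [set g | h g (product_vertex w) = product_vertex w0])).
  (* In each factor the coordinate of [h g x] at [w0 i] exceeds 1/2 - 1/2 = 0, so [w0] is a corner
     of the image cube. *)
  move=> g /= gxy; have [[u' [v' [_ gC]]] _] := act_cubical g cubeC.
  have gx : (h g @` C) (h g x) by exists x.
  have : (h g @` C) (product_vertex w0).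
    rewrite gC => i; apply: vertex_cell.
    apply: (@cell_support _ _ _ _ (h g x i)); first by move: gx; rewrite gC; exact.
    have := le_lt_trans (le_trans (coordinate_lipschitz (h g x i) (y i) (w0 i))
      (mdist_coord _ _ i)) gxy.
    rewrite ltr_norml => /andP[lo _]; have := svalP (w i); rewrite -/(w0 i); lra.
  (* The preimage of [w0] in the cube around [x] is a vertex because [h g^-1] is cubical too; hence
     it is one of the corners. *)
  case=> z Cz gz; have [a az] : is_vertex z.
    rewrite -(actVK g z) gz; apply: cubical_vertex; first exact: act_cubical.
    by exists w0.
  exists a => [i|/=]; last by rewrite -gz az.
  by apply: (cell_support (Cz i)); rewrite az vertexE eqxx.
apply: bigcup_finite; first exact: finite_cube_vertices.
by move=> a _; apply: finite_transporter; apply: stab; exists a.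
Qed.

Lemma stabilisers_discontinuous :
  finite_vertex_stabilisers h -> properly_discontinuous h.
Proof.
(* If [z] and [h g z] are both within 1/4 of [x], then [h g x] is within 1/2 of [x], as
   [finite_near] requires. *)
move=> stab x; have e0 : 0 < 1 / 4 :> R by lra.
exists (ball x (1 / 4))°; split; first exact: (open_nbhs_ball x (PosNum e0)).
apply: sub_finite_set (finite_near x x stab) => g [_ [/[swap] [[z xz <-]] xgz]].
move: xz xgz => /interior_subset + /interior_subset.
rewrite !ballEmdist/= => xz xgz.
apply: le_lt_trans (metric_triangle _ (h g z) _) _.
by rewrite act_isom [X in _ + X]metric_sym; lra.
Qed.

Lemma discontinuous_stabilisers :
  properly_discontinuous h -> finite_vertex_stabilisers h.
Proof.
move=> pd v _; have [U [[_ Uv] fin]] := pd v.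
by apply: sub_finite_set fin => g gv; exists v; split=> //; exists v.
Qed.

Lemma proper_stabilisers : proper_action h -> finite_vertex_stabilisers h.
Proof.
move=> proper v _; have fin := proper [set v] (@compact_set1 P v).
apply: sub_finite_set fin => g gv.
by exists v; split=> //; exists v.
Qed.

(** Cover [C] by finitely many balls of radius 1/4. An element moving a point of the ball at [x]
    into the ball at [y] moves [x] to within 1/2 of [y], and there are finitely many pairs of
    centres. *)
Lemma stabilisers_proper : finite_vertex_stabilisers h -> proper_action h.
Proof.
move=> stab C cC.
have [|s [_ sC]] := @compact_ball_cover _ _ C (fun=> 1 / 4) cC.
  by move=> _; lra.
apply: (@sub_finite_set _ _ (\bigcup_(x in [set` s]) \bigcup_(y in [set` s])
    [set g | mdist (h g x) y < 1 / 2])); last first.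
  by do 2!apply: bigcup_finite => // ? _; exact: finite_near.
move=> g [_ [[z Cz <-] Cgz]].
have [x xs xz] := sC _ Cz; have [y ys yz] := sC _ Cgz.
exists x => //; exists y => //=.
apply: le_lt_trans (metric_triangle _ (h g z) _) _.
by rewrite act_isom [X in _ + X]metric_sym; lra.
Qed.

Lemma metrically_proper_proper : metrically_proper h -> proper_action h.
Proof.
move=> mp C cC; apply: mp.
have [|s [_ sC]] := @compact_ball_cover _ _ C (fun=> 1) cC; first by [].
have [->|/set0P[p Cp]] := eqVneq C set0; first by exists 0.
(* The sum bounds the distance from [p] to every centre, and each point of [C] is within 1 of a
   centre. *)
pose S := \sum_(a <- s) mdist p a; exists ((S + 1) + (S + 1)).
suff near_p x : C x -> mdist p x <= S + 1.
  move=> x y Cx Cy; apply: le_trans (metric_triangle _ p _) _.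
  by rewrite metric_sym lerD ?near_p.
move=> /sC[a sa ax]; apply: le_trans (metric_triangle _ a _) _.
apply: lerD; last exact: ltW.
rewrite /S (big_rem a)//= lerDl.
by apply: sumr_ge0 => b _; exact: mdist_ge0.
Qed.

(** A ball condition at the single point [x] leaves only finitely many group elements near [h k].
    Each of them acting differently from [k] is then excluded by an open condition at one point
    where the two maps differ. *)
Lemma discrete_image_near x (e : R) : 0 < e ->
    (forall k, finite_set [set g | mdist (h g x) (h k x) < e]) ->
  finite_kernel_discrete_image h.
Proof.
move=> e0 fin; split.
  apply: sub_finite_set (fin 1%g) => g /= ->.
  by rewrite (aut_act1 hP) mdistxx.
move=> hG _ [k _ <-]; split; first by apply/mem_set; exists k.
have /finite_fsetP[s sE] := fin k.
(* A point separating [h g] from [h k]; [x] is a dummy value when the two maps are equal. *)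
have q g : {z | h g <> h k -> h g z <> h k z}.
  apply: cid; have [gk|/eqP gk] := eqVneq (h g) (h k); first by exists x.
  apply: contrapT => /forallNP H; apply: gk; apply/funext => z.
  by apply: contrapT => gkz; apply: (H z).
pose V g := [set f : {compact-open, P -> P} |
  h g <> h k -> f (sval (q g)) <> h g (sval (q g))].
exists ([set f : {compact-open, P -> P} | ball (h k x) e (f x)] `&`
  \bigcap_(g in [set` s]) V g).
  apply: filterI.
    by apply: evaluation_compact_open; exact: nbhsx_ballx.
  apply: filter_bigI => g _; have [gk|/eqP gk] := eqVneq (h g) (h k).
    by apply: filterS filterT => f _ /(_ gk).
  apply: (@filterS _ _ _ [set f : {compact-open, P -> P} |
      (~` [set h g (sval (q g))]) (f (sval (q g)))]).
    by move=> f fg _.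
  apply: evaluation_compact_open; apply: open_nbhs_nbhs; split.
    rewrite openC; apply: accessible_closed_set1.
    by apply: hausdorff_accessible; exact: metric_hausdorff.
  by move=> /= kg; apply: (svalP (q g)).
apply/seteqP; split=> [f [[/= kf Vf] [g _ gf]]|_ ->].
  apply: contrapT => gk; move: kf Vf gk; rewrite -gf => kg Vg gk.
  have gs : [set` s] g.
    by rewrite -sE /= metric_sym; move: kg; rewrite ballEmdist.
  exact: (Vg g gs).
split; last by exists k.
split; first exact: ballxx.
by move=> g _ gk /esym; exact: (svalP (q g)).
Qed.

Lemma discontinuous_discrete_image :
  properly_discontinuous h -> finite_kernel_discrete_image h.
Proof.
move/discontinuous_stabilisers => stab.
have v i : T i := sval (cid (tree_nonempty (T i))).
apply: (@discrete_image_near (product_vertex v) (1 / 2)); first by lra.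
by move=> k; exact: finite_near.
Qed.

End ProperActions.

(** * Trees built from a parent function *)

Section RootedTree.
Variables (V : eqType) (root : V) (depth : V -> nat) (parent : V -> V).
Hypothesis depth_root : forall v, depth v = 0%N -> v = root.
Hypothesis depth_parent : forall v,
  (0 < depth v)%N -> depth v = (depth (parent v)).+1.

Definition rooted_adj : rel V := fun u v =>
  (0 < depth u)%N && (parent u == v) || (0 < depth v)%N && (parent v == u).

Lemma rooted_adj_sym : symmetric rooted_adj.
Proof. by move=> u v; rewrite /rooted_adj orbC. Qed.

Lemma rooted_adj_irr : irreflexive rooted_adj.
Proof.
move=> u; rewrite /rooted_adj orbb; apply/negP => /andP[u0 /eqP pu].
by have /eqP := depth_parent u0; rewrite pu -[X in X == _]addn0 -addn1 eqn_add2l.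
Qed.

Lemma path_to_root u : exists p, path rooted_adj u p /\ last u p = root.
Proof.
have [d] := ubnP (depth u); elim: d u => // d IH u ud.
have [/depth_root ->|u0] := posnP (depth u); first by exists [::].
have [|p [pp lp]] := IH (parent u); first by rewrite -ltnS -depth_parent.
by exists (parent u :: p); rewrite /= pp {1}/rooted_adj u0 eqxx.
Qed.

Lemma path_from_root v : exists p, path rooted_adj root p /\ last root p = v.
Proof.
have [p [pp lp]] := path_to_root v; exists (rev (belast v p)); split.
  rewrite -lp rev_path; apply: sub_path pp => a b.
  by rewrite rooted_adj_sym.
case: p {pp} lp => [|a p] /= lp; first by rewrite lp.
by rewrite rev_cons last_rcons.
Qed.

Lemma rooted_connected u v :
  exists p, path rooted_adj u p /\ last u p = v.
Proof.
have [p [pp lp]] := path_to_root u; have [q [pq lq]] := path_from_root v.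
by exists (p ++ q); rewrite cat_path last_cat lp pp pq.
Qed.

Lemma rooted_adj_le u v :
  rooted_adj u v -> (depth v <= depth u)%N -> parent u = v.
Proof.
case/orP=> /andP[d0 /eqP E] //; rewrite (depth_parent d0) E.
by rewrite ltnn.
Qed.

(* Both cyclic neighbours of a vertex of maximal depth are its parent. *)
Lemma rooted_acyclic c : ucycle rooted_adj c -> (size c <= 2)%N.
Proof.
case: c => // x c; set s := x :: c => cyc.
have [i _ imax] :=
  @arg_maxnP _ (@ord0 (size c)) xpredT (fun i => depth (nth x s i)) isT.
set m := nth x s i in imax.
have ms : m \in s by rewrite mem_nth.
have mmax v : v \in s -> (depth v <= depth m)%N.
  move=> vs; have vi : (index v s < (size c).+1)%N by rewrite -index_mem in vs.
  by have := imax (Ordinal vi) isT; rewrite /= nth_index.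
(* Rotate the cycle to start at [m]; its two cyclic neighbours are then the first and last entries
   of [r], which coincide only in a cycle of length at most 2. *)
have [k r rE] := rot_to ms.
have : ucycle rooted_adj (m :: r) by rewrite -rE rot_ucycle.
have -> : size s = (size r).+1 by rewrite -(size_rot k) rE.
have {}mmax v : v \in r -> (depth v <= depth m)%N.
  by move=> vr; apply: mmax; rewrite -(mem_rot k) rE inE vr orbT.
case: r mmax {rE} => // a r; case/lastP: r => // r b mmax.
rewrite /ucycle /= rcons_path last_rcons => /andP[/andP[ma /andP[_ bm]]].
move=> /and3P[_ /negP []].
have <- : parent m = a by apply: rooted_adj_le => //; apply: mmax; rewrite inE eqxx.
have -> : parent m = b; last by rewrite mem_rcons inE eqxx.
apply: rooted_adj_le; first by rewrite rooted_adj_sym.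
by apply: mmax; rewrite inE mem_rcons inE eqxx orbT.
Qed.

Definition rooted_tree : tree := Tree (ex_intro _ root I)
  rooted_adj_sym rooted_adj_irr rooted_connected rooted_acyclic.

End RootedTree.

(** * From actions on the vertices of a tree to actions on powers of its realization *)

Section InducedAction.
Variables (R : realType) (T : tree) (G : groupType) (phi : G -> T -> T).
Hypothesis phi1 : forall u, phi 1%g u = u.
Hypothesis phiM : forall g k u, phi (g * k)%g u = phi g (phi k u).
Hypothesis phi_adj : forall g u v, adj u v -> adj (phi g u) (phi g v).

Let phiK g : cancel (phi g) (phi g^-1%g).
Proof. by move=> u; rewrite -phiM mulVg phi1. Qed.

Let phiVK g : cancel (phi g^-1%g) (phi g).
Proof. by move=> u; rewrite -phiM mulgV phi1. Qed.

Lemma simplex_phi g u v : simplex u v -> simplex (phi g u) (phi g v).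
Proof. by case/orP=> [/eqP ->|/phi_adj uv]; rewrite /simplex ?eqxx// uv orbT. Qed.

Lemma bary_phi g u v (t : R) :
  (fun w => bary u v t (phi g^-1%g w)) = bary (phi g u) (phi g v) t.
Proof.
by apply/funext => w; rewrite /bary -!(can2_eq (phiVK g) (phiK g)).
Qed.

Lemma is_point_phi g (x : realization R T) :
  `[< is_point (fun w => sval x (phi g^-1%g w)) >].
Proof.
have /asboolP[u [v [t [uv ht ->]]]] := valP x; apply/asboolP.
by exists (phi g u), (phi g v), t; split; rewrite ?bary_phi//; exact: simplex_phi.
Qed.

(** Points are functions on the vertices, so precomposing with the inverse gives a left action. *)
Definition tree_act g (x : realization R T) : realization R T :=
  exist _ (fun w => sval x (phi g^-1%g w)) (is_point_phi g x).

Lemma tree_act1 x : tree_act 1%g x = x.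
Proof. by apply/val_inj/funext => w; rewrite /= invg1 phi1. Qed.

Lemma tree_actM g k x : tree_act (g * k)%g x = tree_act g (tree_act k x).
Proof. by apply/val_inj/funext => w; rewrite /= invgM phiM. Qed.

Lemma tree_act_vertex g u : tree_act g (vertex u) = vertex (phi g u).
Proof. by apply/val_inj; rewrite /= bary_phi. Qed.

Lemma tree_act_cell g u v x :
  cell u v x -> cell (phi g u) (phi g v) (tree_act g x).
Proof. by case=> t ht xE; exists t; rewrite //= xE bary_phi. Qed.

Lemma tree_act_chain g x y l :
  chain x y l -> chain (tree_act g x) (tree_act g y) l.
Proof.
elim=> {x y l} [x|x y z u v s t l uv hs ht xE yE _]; first exact: chain_nil.
apply: chain_cons (phi_adj g uv) hs ht _ _.
  by rewrite /= xE bary_phi.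
by rewrite /= yE bary_phi.
Qed.

Lemma tree_act_isom g x y : mdist (tree_act g x) (tree_act g y) = mdist x y.
Proof.
have le k a b : mdist (tree_act k a) (tree_act k b) <= mdist a b.
  apply: lb_le_inf; first exact: chain_exists.
  by move=> l /= /(tree_act_chain k) /mdist_chain.
apply/le_anti; rewrite le/=.
by have := le g^-1%g (tree_act g x) (tree_act g y);
  rewrite -!tree_actM mulVg !tree_act1.
Qed.

Variable n : nat.
Local Notation P := (tree_product R (fun _ : 'I_n => T)).

Definition diagonal_act (g : G) (x : P) : P := fun i => tree_act g (x i).

Lemma diagonal_actM g k x :
  diagonal_act (g * k)%g x = diagonal_act g (diagonal_act k x).
Proof. by apply/funext => i; exact: tree_actM. Qed.

Lemma diagonal_act1 x : diagonal_act 1%g x = x.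
Proof. by apply/funext => i; exact: tree_act1. Qed.

Lemma diagonal_act_vertex g (v : 'I_n -> T) :
  diagonal_act g (product_vertex v) = product_vertex (fun i => phi g (v i)).
Proof. by apply/funext => i; exact: tree_act_vertex. Qed.

Lemma diagonal_act_cubical g : cubical (diagonal_act g).
Proof.
move=> _ [u [v [uv ->]]]; split; last first.
  move=> x y _ _; rewrite !mdist_prodE; congr Num.sqrt.
  by apply: eq_bigr => i _; rewrite tree_act_isom.
exists (fun i => phi g (u i)), (fun i => phi g (v i)).
split=> [i|]; first exact: simplex_phi.
apply/seteqP; split=> [_ [x xuv <-] i|y yuv]; first exact: tree_act_cell.
exists (diagonal_act g^-1%g y) => [i|]; last first.
  by rewrite -diagonal_actM mulgV diagonal_act1.
by have := tree_act_cell g^-1%g (yuv i); rewrite !phiK.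
Qed.

Lemma diagonal_act_aut : aut_action diagonal_act.
Proof.
split; [exact: diagonal_act1 | exact: diagonal_actM | move=> g].
exists (diagonal_act g^-1%g); split; try exact: diagonal_act_cubical.
  by move=> x; rewrite -diagonal_actM mulVg diagonal_act1.
by move=> x; rewrite -diagonal_actM mulgV diagonal_act1.
Qed.

End InducedAction.

(** * Reduced words and the free product of groups of order two *)

Section Words.
Implicit Types (u v w : seq nat) (a b : nat).

Definition reduced w : bool := sorted (fun a b => a != b) w.

(** Left multiplication of a reduced word by the involution [a], cancelling [a a]. *)
Definition push a w :=
  if w is b :: w' then if a == b then w' else a :: w else [:: a].

Lemma push_reduced a w : reduced w -> reduced (push a w).
Proof.
case: w => //= b w bw; case: eqP => [_|/eqP ab]; first exact: path_sorted bw.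
by rewrite /= ab.
Qed.

Lemma pushK a w : reduced w -> push a (push a w) = w.
Proof.
case: w => [|b w] /=; first by rewrite eqxx.
have [->|ab] := eqVneq a b; last by rewrite /= eqxx.
(* After cancellation the next letter differs from [b], so the second push restores [b]. *)
by case: w => //= c w /andP[/negPf ->].
Qed.

Lemma push_cons a w : reduced (a :: w) -> push a w = a :: w.
Proof. by case: w => //= b w /andP[/negPf ->]. Qed.

Definition word_mul u v := foldr push v u.

Lemma word_mul_reduced u v : reduced v -> reduced (word_mul u v).
Proof. by move=> rv; elim: u => //= a u; exact: push_reduced. Qed.

(** The core of associativity: if the push cancels a letter of [u], then on the right that letter
    acts twice, which is trivial by [pushK]. *)
Lemma word_mul_push a u v :
  reduced v -> word_mul (push a u) v = push a (word_mul u v).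
Proof.
move=> rv; case: u => //= b u; have [->|//] := eqVneq a b.
by rewrite pushK//; exact: word_mul_reduced.
Qed.

Lemma word_mulA u v w : reduced w ->
  word_mul (word_mul u v) w = word_mul u (word_mul v w).
Proof. by move=> rw; elim: u => //= a u IH; rewrite word_mul_push// IH. Qed.

Lemma word_mulw1 u : reduced u -> word_mul u [::] = u.
Proof.
elim: u => //= a u IH ru; rewrite IH; first exact: push_cons.
exact: path_sorted ru.
Qed.

Lemma word_mul_rev u : word_mul (rev u) u = [::].
Proof.
elim: u => //= a u IH; rewrite rev_cons /word_mul foldr_rcons /= eqxx.
exact: IH.
Qed.

Lemma rev_reduced u : reduced (rev u) = reduced u.
Proof. by rewrite /reduced rev_sorted; apply: eq_sorted => a b; rewrite eq_sym. Qed.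

Lemma behead_reduced u : reduced u -> reduced (behead u).
Proof. by case: u => //= a u /path_sorted. Qed.

End Words.

(* The free product of countably many groups of order two. *)
Definition free_involutions : Type := {w : seq nat | reduced w}.

HB.instance Definition _ :=
  Choice.copy free_involutions {w : seq nat | reduced w}.

Local Notation W := free_involutions.

Definition word (w : W) : seq nat := sval w.

Definition wmul (u v : W) : W :=
  exist _ (word_mul (word u) (word v)) (word_mul_reduced (word u) (valP v)).

Definition winv (u : W) : W :=
  exist _ (rev (word u)) (etrans (rev_reduced (word u)) (valP u)).

Definition wone : W := exist _ [::] isT.

Lemma wmulA : associative wmul.
Proof. by move=> u v w; apply/val_inj; rewrite /= word_mulA//; exact: (valP w). Qed.

Lemma wmul1 : left_id wone wmul.
Proof. by move=> u; apply/val_inj. Qed.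

Lemma wmulr1 : right_id wone wmul.
Proof. by move=> u; apply/val_inj; rewrite /= word_mulw1//; exact: (valP u). Qed.

Lemma wmulV : left_inverse wone winv wmul.
Proof. by move=> u; apply/val_inj; rewrite /= word_mul_rev. Qed.

Lemma wmulrV : right_inverse wone winv wmul.
Proof.
by move=> u; apply/val_inj; rewrite /= -{1}[word u]revK word_mul_rev.
Qed.

HB.instance Definition _ :=
  isGroup.Build free_involutions wmulA wmul1 wmulr1 wmulV wmulrV.

Definition generator (a : nat) : W := exist _ [:: a] isT.

Lemma generator_inj : injective generator.
Proof. by move=> a b /(congr1 word) []. Qed.

Lemma generatorV a : ((generator a)^-1)%g = generator a.
Proof. exact/val_inj. Qed.

Lemma infinite_free_involutions : infinite_set [set: W].
Proof.
move=> fin; apply: infinite_nat.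
apply: (@sub_finite_set _ _ (generator @^-1` setT)) => //.
by apply: finite_preimage fin => a b _ _; exact: generator_inj.
Qed.

(** * The Cayley tree of the free product and its translations *)

Definition wparent (w : W) : W := exist _ (behead (word w)) (behead_reduced (valP w)).

Lemma word_depth0 (w : W) : size (word w) = 0%N -> w = wone.
Proof. by move/size0nil => w0; apply/val_inj. Qed.

Lemma word_depthS (w : W) : (0 < size (word w))%N ->
  size (word w) = (size (word (wparent w))).+1.
Proof. by rewrite /= size_behead => /prednK. Qed.

Definition word_tree : tree := rooted_tree word_depth0 word_depthS.

(** Edges are left multiplications by generators, a description that right multiplication visibly
    preserves. *)
Lemma word_adjP (u v : W) :
  reflect (exists a, word v = push a (word u)) (@adj word_tree u v).
Proof.
have -> : @adj word_tree u v =
    (0 < size (word u))%N && (behead (word u) == word v) ||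
    (0 < size (word v))%N && (behead (word v) == word u) by [].
case: u v => [u ru] [v rv]; rewrite /word /=.
apply: (iffP orP) => [[] /andP[+ /eqP E]|[a ->]].
- by case: u E {ru} => //= a u -> _; exists a; rewrite eqxx.
- by case: v E rv => //= a v <- rv _; exists a; rewrite push_cons.
case: u {ru} => [|b u] /=; first by right.
by case: (a == b) => /=; [left|right]; rewrite eqxx.
Qed.

Definition right_translation (g : W) (w : word_tree) : word_tree :=
  ((w : W) * g^-1)%g.

Lemma right_translation1 w : right_translation 1%g w = w.
Proof. by rewrite /right_translation invg1 mulg1. Qed.

Lemma right_translationM (g k : W) w :
  right_translation (g * k)%g w = right_translation g (right_translation k w).
Proof. by rewrite /right_translation invgM mulgA. Qed.

Lemma right_translation_adj (g : W) (u v : word_tree) :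
  adj u v -> adj (right_translation g u) (right_translation g v).
Proof.
move=> /word_adjP[a E]; apply/word_adjP; exists a.
change (word_mul (word v) (word g^-1%g) =
  push a (word_mul (word u) (word g^-1%g))).
by rewrite E word_mul_push//; exact: (valP g^-1%g).
Qed.

(** * Examples showing that the two implications are strict *)

Section Examples.
Variable R : realType.

Local Notation PW := (tree_product R (fun _ : 'I_1 => word_tree)).

Definition word_act : W -> PW -> PW :=
  diagonal_act right_translation1 right_translationM right_translation_adj (n := 1).

Lemma word_act_aut : aut_action word_act.
Proof. exact: diagonal_act_aut. Qed.

Lemma vertex_inj (T : tree) : injective (@vertex R T).
Proof.
move=> u v uv; have := vertexE R u u; rewrite uv vertexE eqxx.
by have [//|_ /eqP] := eqVneq u v; rewrite eq_sym oner_eq0.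
Qed.

(** Translations act freely on the vertices, so all vertex stabilisers are trivial. *)
Lemma word_act_proper : proper_action word_act.
Proof.
apply: (stabilisers_proper word_act_aut) => _ [v ->].
apply: (@sub_finite_set _ _ [set 1%g]) => [g /=|]; last exact: finite_set1.
rewrite /word_act diagonal_act_vertex => /(congr1 (fun x : PW => x ord0)).
move=> /vertex_inj; rewrite /right_translation => E.
by apply/invg_inj/(@mulgI _ (v ord0 : W)); rewrite E invg1 mulg1.
Qed.

(** The closed unit ball at the root is bounded, and each of the infinitely many generators moves
    its centre to a neighbouring vertex. *)
Lemma word_act_not_metrically_proper : ~ metrically_proper word_act.
Proof.
pose root : word_tree := (1%g : W); pose o : PW := product_vertex (fun=> root).
pose C := [set x | mdist o x <= 1].
have bC : metric_bounded C.
  exists (1 + 1) => x y ox oy; apply: le_trans (metric_triangle _ o _) _.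
  by rewrite metric_sym lerD.
have near_o a : mdist o (word_act (generator a) o) <= 1.
  rewrite mdist_prodE big_ord1 sqrtr_sqr ger0_norm ?mdist_ge0//.
  rewrite /word_act diagonal_act_vertex; apply: mdist_chain.
  have uv : adj root (right_translation (generator a) root).
    apply/word_adjP; exists a.
    by rewrite /right_translation generatorV mul1g.
  have -> : 1 = `|0 - 1| + 0 :> R by rewrite sub0r normrN1 addr0.
  apply: chain_cons uv _ _ _ _ (chain_nil _); rewrite ?lexx ?ler01//=.
    by rewrite (bary0 _ (right_translation (generator a) root)).
  by rewrite (bary1 root).
move=> /(_ C bC) fin; apply: infinite_nat.
apply: (@sub_finite_set _ _ (generator @^-1`
    [set g | word_act g @` C `&` C !=set0])).
  move=> a _; exists (word_act (generator a) o); split; last exact: near_o.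
  by exists o => //; rewrite /C /= mdistxx.
by apply: finite_preimage fin => a b _ _; exact: generator_inj.
Qed.

(** * The star with leaves indexed by a group *)

Section Star.
Variable G : groupType.

(** The centre is [None], and the boolean is coerced to depth 0 or 1. *)
Definition star_depth (x : option G) : nat := isSome x.

Lemma star_depth_root x : star_depth x = 0%N -> x = None.
Proof. by case: x. Qed.

Lemma star_depth_parent x :
  (0 < star_depth x)%N -> star_depth x = (star_depth None).+1.
Proof. by case: x. Qed.

Definition star : tree :=
  @rooted_tree _ None star_depth (fun=> None) star_depth_root star_depth_parent.

Definition star_translation (g : G) : star -> star := omap (fun k => g * k)%g.

Lemma star_translation1 x : star_translation 1%g x = x.
Proof. by case: x => //= k; rewrite mul1g. Qed.

Lemma star_translationM (g k : G) x :
  star_translation (g * k)%g x = star_translation g (star_translation k x).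
Proof. by case: x => //= l; rewrite mulgA. Qed.

Lemma star_translation_adj (g : G) (x y : star) :
  adj x y -> adj (star_translation g x) (star_translation g y).
Proof. by case: x y => [x|] [y|]. Qed.

Definition star_act : G -> _ -> tree_product R (fun _ : 'I_1 => star) :=
  diagonal_act star_translation1 star_translationM star_translation_adj (n := 1).

Lemma star_act_aut : aut_action star_act.
Proof. exact: diagonal_act_aut. Qed.

(** Distinct leaves are at distance at least 1, as the coordinate at one of them shows, so the image
    of the leaf [1] up to error 1/2 determines the group element. *)
Lemma star_act_discrete_image : finite_kernel_discrete_image star_act.
Proof.
pose leaf (g : G) : star := Some g.
apply: (@discrete_image_near _ _ _ _ _ star_act_aut
  (product_vertex (fun=> leaf 1%g)) (1 / 2)); first by lra.
move=> k; apply: (@sub_finite_set _ _ [set k]); last exact: finite_set1.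
move=> g /= gk; apply: contrapT => gNk.
have := le_lt_trans (le_trans (coordinate_lipschitz _ _ (leaf k))
  (mdist_coord _ _ ord0)) gk.
rewrite /star_act !diagonal_act_vertex /product_vertex !vertexE.
rewrite /leaf /= !mulg1 eqxx.
have -> : (Some k == Some g) = false by apply/eqP => -[/esym].
by rewrite sub0r normrN1; lra.
Qed.

(** The whole group stabilises the centre. *)
Lemma star_act_not_discontinuous :
  infinite_set [set: G] -> ~ properly_discontinuous star_act.
Proof.
move=> infG /discontinuous_stabilisers stab; apply: infG.
have fin := stab (product_vertex (fun=> None : star)) (ex_intro _ _ erefl).
apply: sub_finite_set fin => g _ /=.
by rewrite /star_act diagonal_act_vertex.
Qed.

End Star.

End Examples.

Theorem proposition4p1 (R : realType) :
  (forall (n : nat) (T : 'I_n -> tree),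
    Aut_product T `<=` Isom_product (R := R) T /\
    (forall f : tree_product R T -> tree_product R T, Isom_product T f ->
      within (Isom_product T)
        (nbhs (f : {compact-open, tree_product R T -> tree_product R T})) =
      within (Isom_product T)
        (nbhs (f : {ptws tree_product R T -> tree_product R T}))) /\
    (forall (G : groupType) (h : G -> tree_product R T -> tree_product R T),
      aut_action h ->
      [/\ metrically_proper h -> proper_action h,
          proper_action h <-> finite_vertex_stabilisers h,
          finite_vertex_stabilisers h <-> properly_discontinuous h &
          properly_discontinuous h -> finite_kernel_discrete_image h])) /\
  (exists (n : nat) (T : 'I_n -> tree) (G : groupType)
      (h : G -> tree_product R T -> tree_product R T),
    [/\ aut_action h, proper_action h & ~ metrically_proper h]) /\
  (exists (n : nat) (T : 'I_n -> tree) (G : groupType)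
      (h : G -> tree_product R T -> tree_product R T),
    [/\ aut_action h, finite_kernel_discrete_image h &
        ~ properly_discontinuous h]).
Proof.
split; [|split].
- move=> n T; split; first exact: Aut_product_isom.
  split; first exact: Isom_compact_open_ptws.
  move=> G h hP; split.
  + exact: metrically_proper_proper.
  + split; first exact: proper_stabilisers.
    exact: stabilisers_proper.
  + split; first exact: stabilisers_discontinuous.
    exact: discontinuous_stabilisers.
  + exact: discontinuous_discrete_image.
- exists 1%N, (fun=> word_tree), free_involutions, (word_act (R := R)).
  split; [exact: word_act_aut | exact: word_act_proper |].
  exact: word_act_not_metrically_proper.
- exists 1%N, (fun=> star free_involutions), free_involutions.
  exists (star_act (R := R) (G := free_involutions)).
  split; [exact: star_act_aut | exact: star_act_discrete_image |].
  exact: star_act_not_discontinuous infinite_free_involutions.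
Qed.
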